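(* Let $b>0$, and define $t_1=1$, $\mu_1=b\lVert K\rVert^2$, and for every $k\ge1$ $$t_{k+1}:=\sqrt{t_k^2+2t_k},\qquad \mu_{k+1}:=\mu_k\frac{t_k^2}{t_{k+1}^2-t_{k+1}},\qquad \gamma_k:=\frac{\mu_k}{\lVert K\rVert^2}.$$ Then for every $k\ge1$ $$\mu_k-\mu_{k+1}-\frac{\mu_{k+1}}{t_{k+1}}\le0\qquad\text{and}\qquad\left(1-\frac1{t_{k+1}}\right)\gamma_{k+1}t_{k+1}^2=\gamma_kt_k^2 .$$ Moreover, if $(x_k)_{k\ge0}$ is the sequence generated by the VAST algorithm (defined in the context) with these parameters, then for every optimal solution $x^*$ of $\min_{x\in\mathcal H}F(x)$ and every $N\ge1$, $$F(x_N)-F(x^* )\le\frac{\lVert x_0-x^*\rVert^2}{b(N+1)}+\frac{bL_g^2\lVert K\rVert^2}{N+1}\exp\left(\frac{4\pi^2}{6}\right).$$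
   Context: $\mathcal H,\mathcal G$ are real Hilbert spaces; $f:\mathcal H\to\overline{\mathbb R}$ (extended reals) is proper, convex and lower semicontinuous; $g:\mathcal G\to\mathbb R$ is convex and $L_g$-Lipschitz continuous with $L_g>0$; $K:\mathcal H\to\mathcal G$ is a nonzero continuous linear operator with adjoint $K^*$. Put $F:=f+g\circ K$. $g^*$ denotes the convex (Fenchel) conjugate of $g$, and $\operatorname{prox}_{h}(x)$ denotes the unique minimizer of $u\mapsto h(u)+\frac12\lVert u-x\rVert^2$ for $h$ proper, convex, lower semicontinuous. VAST algorithm: let $y_0=x_0\in\mathcal H$, let $(\mu_k)_{k\ge1}$ be a sequence in $(0,+\infty)$, and let $(t_k)_{k\ge1}$ be real numbers with $t_1=1$ and $t_k\ge 1$ for all $k\ge2$. For every $k\ge1$ set $L_k=\frac{\lVert K\rVert^2}{\mu_k}$, $\gamma_k=\frac1{L_k}$, $$x_k=\operatorname{prox}_{\gamma_k f}\!\left(y_{k-1}-\gamma_k K^*\operatorname{prox}_{\frac1{\mu_k}g^*}\!\left(\tfrac{Ky_{k-1}}{\mu_k}\right)\right),\qquad y_k=x_k+\frac{t_k-1}{t_{k+1}}(x_k-x_{k-1}).$$ *)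

(* Defs.v *)
From HB Require Import structures.
From mathcomp Require Import all_boot all_order all_algebra sesquilinear.
From mathcomp Require Import all_classical all_reals all_analysis.

Set Implicit Arguments.
Unset Strict Implicit.
Unset Printing Implicit Defensive.

Import Order.TTheory GRing.Theory Num.Theory.
Import numFieldNormedType.Exports.

Local Open Scope classical_set_scope.
Local Open Scope ring_scope.

(* A real Hilbert space: a Banach space whose norm comes from an inner
   product, i.e. from a positive definite symmetric bilinear form. *)
HB.mixin Record CompleteNormedModule_isHilbert (R : realType) (V : Type)
    of CompleteNormedModule R V := {
  inner : {dot V for (@idfun R)} ;
  inner_norm : forall x : V, inner x x = `|x| ^+ 2
}.

#[short(type="hilbertType")]
HB.structure Definition Hilbert (R : realType) :=
  {V of CompleteNormedModule R V & CompleteNormedModule_isHilbert R V}.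

Definition opnorm (R : realType) (H G : hilbertType R) (K : H -> G) : R :=
  sup [set `|K x| | x in [set x : H | `|x| <= 1]].

(* For K linear and continuous the set below is a singleton (Riesz). *)
Definition adjoint (R : realType) (H G : hilbertType R) (K : H -> G) (y : G) : H :=
  xget 0 [set z : H | forall x : H, inner (K x) y = inner x z].

Definition minimizer (R : realType) (T : Type) (h : T -> \bar R) (x : T) : Prop :=
  forall u : T, (h x <= h u)%E.

Definition proper_fun (R : realType) (T : Type) (h : T -> \bar R) : Prop :=
  (forall x, h x != -oo%E) /\ (exists x, h x != +oo%E).

(* Quantifying over the effective domain only avoids the sum (+oo) + (-oo). *)
Definition econvex_function (R : realType) (H : lmodType R)
    (h : H -> \bar R) : Prop :=
  forall (x y : H) (a : R), (h x < +oo)%E -> (h y < +oo)%E -> 0 < a < 1 ->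
  (h (a *: x + (1 - a) *: y)%R <= a%:E * h x + (1 - a)%:E * h y)%E.

Definition conjugate (R : realType) (H : hilbertType R)
    (h : H -> \bar R) (p : H) : \bar R :=
  ereal_sup (range (fun x : H => ((inner x p)%:E - h x)%E)).

(* For h proper, convex and lower semicontinuous the minimizer exists and is
   unique. *)
Definition prox (R : realType) (H : hilbertType R)
    (h : H -> \bar R) (x : H) : H :=
  xget 0 [set p : H | minimizer (fun u => h u + (2^-1 * `|u - x| ^+ 2)%:E)%E p].

(* The standing requirements mu k > 0, t 1 = 1 and t k >= 1 of the algorithm
   constrain its parameters only; they are left to the context of use. *)
Definition VAST (R : realType) (H G : hilbertType R)
    (f : H -> \bar R) (g : G -> R) (K : H -> G)
    (mu t : nat -> R) (x y : nat -> H) : Prop :=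
  y 0%N = x 0%N /\
  forall k : nat, (0 < k)%N ->
    let L := opnorm K ^+ 2 / mu k in
    let gamma := L^-1 in
    let prox_conj :=
      prox (fun p => ((mu k)^-1)%:E * conjugate (EFin \o g) p)%E in
    x k = prox (fun u => gamma%:E * f u)%E
            (y k.-1 - gamma *: adjoint K (prox_conj ((mu k)^-1 *: K (y k.-1)))) /\
    y k = x k + ((t k - 1) / t k.+1) *: (x k - x k.-1).

(* Main.v *)
(* Let v be the proximal point of mu g at z and p = (z - v) / mu. Then p is a
   subgradient of g at v, and completing the square shows that it is the proximal
   point of g^* / mu at z / mu, that is, the gradient at z of the Moreau envelope
   g_mu. One VAST step is thus a proximal gradient step on F_k = f + g_(mu_k) o K.
   With u_k = x_(k-1) + t_k (x_k - x_(k-1)), the energy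
     gamma_k t_k^2 (F_k (x_k) - F x^* ) + |u_k - x^* |^2 / 2
   is nonincreasing: the linearization of g_mu lies below g by mu |p|^2 / 2, and
   this gain at x^* pays for the increase of the envelope when mu_k drops to
   mu_(k+1), which is the condition mu_k - mu_(k+1) - mu_(k+1) / t_(k+1) <= 0.
   The rate follows from gamma_N t_N^2 >= b N, the smoothing gap mu_N L_g^2 / 2,
   and gamma_N (t_N + 2) <= 3 b with t_N >= (N + 1) / 2; here 3 is far below
   exp (4 pi^2 / 6). *)
Require Import Defs.
From HB Require Import structures.
From mathcomp Require Import all_boot all_order all_algebra sesquilinear.
From mathcomp Require Import all_classical all_reals all_analysis.
From mathcomp Require Import ring lra.

Set Implicit Arguments.
Unset Strict Implicit.
Unset Printing Implicit Defensive.

Import Order.TTheory GRing.Theory Num.Theory.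
Import numFieldNormedType.Exports.

Local Open Scope classical_set_scope.
Local Open Scope ring_scope.

(** * Inner product calculus *)

Section InnerProduct.
Context (R : realType) (H : hilbertType R).
Implicit Types u v w : H.

Lemma innerC u v : inner u v = inner v u.
Proof. by rewrite hermC /= expr0 mul1r. Qed.

Lemma innerDl u v w : inner (u + v) w = inner u w + inner v w.
Proof. by rewrite linearDl. Qed.

Lemma innerDr u v w : inner u (v + w) = inner u v + inner u w.
Proof. by rewrite linearDr. Qed.

Lemma innerNl u v : inner (- u) v = - inner u v.
Proof. by rewrite linearNl. Qed.

Lemma innerNr u v : inner u (- v) = - inner u v.
Proof. by rewrite linearNr. Qed.

Lemma innerZl a u v : inner (a *: u) v = a * inner u v.
Proof. by rewrite linearZl_LR. Qed.

Lemma innerZr a u v : inner u (a *: v) = a * inner u v.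
Proof. by rewrite linearZr_LR. Qed.

Definition innerE := (innerDl, innerDr, innerNl, innerNr, innerZl, innerZr).

Lemma normD_sqr u v : `|u + v| ^+ 2 = `|u| ^+ 2 + 2 * inner u v + `|v| ^+ 2.
Proof. by rewrite -!inner_norm !innerE (innerC v u); ring. Qed.

Lemma normB_sqr u v : `|u - v| ^+ 2 = `|u| ^+ 2 - 2 * inner u v + `|v| ^+ 2.
Proof. by rewrite -!inner_norm !innerE (innerC v u); ring. Qed.

(** Cauchy-Schwarz: expand the square of the norm of |v| u - |u| v and divide by 2 |u| |v|. *)
Lemma inner_le_norm u v : inner u v <= `|u| * `|v|.
Proof.
have [->|u0] := eqVneq u 0; first by rewrite linear0l normr0 mul0r.
have [->|v0] := eqVneq v 0; first by rewrite linear0r normr0 mulr0.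
have := sqr_ge0 (`|(`|v| *: u - `|u| *: v)|).
rewrite normB_sqr innerE innerZr !normrZ !normr_id => h.
have uv : 0 < `|u| * `|v| by rewrite mulr_gt0 ?normr_gt0.
by rewrite -(ler_pM2l uv); lra.
Qed.

End InnerProduct.

(** * Existence and variational characterization of proximal points *)

Section Prox.
Context (R : realType) (H : hilbertType R).
Implicit Types (h : H -> \bar R) (u x p : H).

Lemma proper_fin h u : proper_fun h -> (h u < +oo)%E -> exists r, h u = r%:E.
Proof.
by move=> [/(_ u) hN _]; case: (h u) hN => [r| |] //= _ _; exists r.
Qed.

(* Lower semicontinuity bounds [h] below on a ball around a point of its domain;
   convexity along rays from that point propagates the bound. This avoids the
   Hahn-Banach theorem. *)
Lemma convex_lower_bound h : proper_fun h -> econvex_function h ->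
  lower_semicontinuous h ->
  exists r c, 0 <= c /\ forall u, ((r - c * `|u|)%:E <= h u)%E.
Proof.
move=> hp hc hl; have [hN [x0 hx0]] := hp.
have [a0 ha0] : exists a, h x0 = a%:E by apply: proper_fin; rewrite ?ltey.
have a0h : ((a0 - 1)%:E < h x0)%E by rewrite ha0 lte_fin ltrBlDr ltrDl.
have [V /nbhs_ballP[e /= e0 eV] hV] := hl x0 (a0 - 1) a0h.
have key u : ((a0 - 1 - 2 / e * `|u - x0|)%:E <= h u)%E.
  have [ue|ue] := ltP `|u - x0| e.
    apply/ltW/(le_lt_trans _ (hV u _)); last first.
      by apply: eV; rewrite -ball_normE /= distrC.
    by rewrite lee_fin gerBl mulr_ge0 // divr_ge0 // ltW.
  have [hu|hu] := ltP (h u) +oo%E; last first.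
    by move: hu; rewrite leye_eq => /eqP ->; rewrite leey.
  have [r hr] := proper_fin hp hu.
  have n0 : 0 < `|u - x0| by exact: lt_le_trans ue.
  (* This weight puts the convex combination of [u] and [x0] at distance [e / 2] from [x0], inside
     the ball where [h] exceeds [a0 - 1]; convexity then bounds [h u] below by [a0 - s^-1]. *)
  pose s := e / 2 / `|u - x0|.
  have s0 : 0 < s by rewrite !divr_gt0.
  have s1 : s < 1 by rewrite ltr_pdivrMr// mul1r (lt_le_trans _ ue)//; lra.
  have hx0' : (h x0 < +oo)%E by rewrite ltey.
  have := hc u x0 s hu hx0' ltac:(by rewrite s0 s1).
  set v := (_ + _)%R => hv.
  have : ((a0 - 1)%:E < h v)%E.
    apply: hV; apply: eV; rewrite -ball_normE /=.
    rewrite (_ : x0 - v = s *: (x0 - u)); last first.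
      by rewrite /v scalerBl scale1r scalerBr opprD opprB addrCA subrKC addrC.
    rewrite normrZ (gtr0_norm s0) distrC divfK ?gt_eqF//; lra.
  move=> /lt_le_trans/(_ hv); rewrite hr ha0 -!EFinM -EFinD lte_fin lee_fin => sr.
  have -> : 2 / e * `|u - x0| = s^-1 by rewrite /s !invfM !invrK; ring.
  rewrite -(ler_pM2l s0) !mulrBr mulfV ?gt_eqF//; nra.
exists (a0 - 1 - 2 / e * `|x0|), (2 / e); split; first by rewrite divr_ge0// ltW.
move=> u; apply: le_trans (key u); rewrite lee_fin.
have := ler_normB u x0; have : 0 < 2 / e by rewrite divr_gt0.
nra.
Qed.

(** Direct method: the quadratic term makes the objective strongly convex, so the parallelogram law
    at midpoints makes a minimizing sequence Cauchy; lower semicontinuity shows that its limit is a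
    minimizer. *)
Lemma prox_exists h x : proper_fun h -> econvex_function h ->
  lower_semicontinuous h ->
  exists p, minimizer (fun u => h u + (2^-1 * `|u - x| ^+ 2)%:E)%E p.
Proof.
move=> hp hc hl; have [r [c [c0 hrc]]] := convex_lower_bound hp hc hl.
have [hN [x0 hx0]] := hp.
pose phi u := fine (h u) + 2^-1 * `|u - x| ^+ 2.
pose S := [set phi u | u in [set u | (h u < +oo)%E]].
have hfin u : (h u < +oo)%E -> h u = (fine (h u))%:E.
  by move=> /(proper_fin hp)[a ->].
have S0 : S !=set0 by exists (phi x0); exists x0 => //=; rewrite ltey.
have Slb : has_lbound S.
  (* With d = |u - x|, the affine bound leaves d^2 / 2 - c d, whose minimum, at d = c, is - c^2 /
     2. *)
  exists (r - c * `|x| - c ^+ 2 / 2) => _ [u /= hu <-]; rewrite /phi.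
  have := hrc u; rewrite hfin// lee_fin.
  have := ler_normD (u - x) x; rewrite subrK.
  have := sqr_ge0 (`|u - x| - c); nra.
pose m := inf S.
have mphi u : (h u < +oo)%E -> m <= phi u.
  by move=> hu; apply: ge_inf => //; exists u.
have /choice[w hw] : forall n : nat, exists u,
    (h u < +oo)%E /\ phi u < m + n.+1%:R^-1.
  move=> n; have [|_ [u hu <-] um] := @inf_adherent R S n.+1%:R^-1 _ (conj S0 Slb).
    by rewrite invr_gt0.
  by exists u.
have wm u v : (h u < +oo)%E -> (h v < +oo)%E ->
    `|u - v| ^+ 2 <= 4 * (phi u + phi v - 2 * m).
  move=> hu hv.
  have h12 : 0 < (2^-1 : R) < 1 by lra.
  have := hc u v _ hu hv h12.
  set z := (_ + _)%R; rewrite (hfin u hu) (hfin v hv) -!EFinM -EFinD => hz.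
  have hz' : (h z < +oo)%E by apply: le_lt_trans hz _; rewrite ltey.
  have := mphi _ hz'; move: hz; rewrite (hfin z hz') lee_fin /phi.
  have -> : z - x = 2^-1 *: ((u - x) + (v - x)).
    rewrite /z [1 - _](_ : _ = 2^-1); last by lra.
    by rewrite -scalerDr addrACA -opprD scalerBr -mulr2n -[x *+ 2]scaler_nat
      scalerA mulVf ?scale1r.
  have -> : u - v = (u - x) - (v - x) by rewrite opprB addrA subrK.
  rewrite normrZ exprMn (normD_sqr _ (v - x)) (normB_sqr (u - x)) ger0_norm//; lra.
have wc : cvg (w @ \oo).
  apply/cauchy_cvgP/cauchy_ballP => e e0.
  (* [wm] bounds the squared distance of two late terms by 4 times the sum of their two errors,
     hence the 8. *)
  have e8 : 0 < e ^+ 2 / 8 by rewrite divr_gt0 ?exprn_gt0.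
  have [N _ hN'] := near_infty_natSinv_lt (PosNum e8).
  exists ([set w n | n in [set n | (N <= n)%N]],
          [set w n | n in [set n | (N <= n)%N]]).
    by split; exists N => // n /= Nn; exists n.
  move=> [_ _] [/= [i Ni <-] [j Nj <-]]; rewrite -ball_normE /=.
  rewrite -(@ltr_pXn2r _ 2)// ?nnegrE// ?ltW//.
  have [hi1 hi2] := hw i; have [hj1 hj2] := hw j.
  have := wm _ _ hi1 hj1; have := hN' _ Ni; have := hN' _ Nj; rewrite /=.
  move: (i.+1%:R^-1) (j.+1%:R^-1) hi2 hj2 => ri rj; lra.
pose p := lim (w @ \oo).
have wp : w @ \oo --> p by [].
exists p.
suff hpm : (h p <= (m - 2^-1 * `|p - x| ^+ 2)%:E)%E.
  have hpf : (h p < +oo)%E by apply: le_lt_trans hpm _; rewrite ltey.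
  move=> u; have [hu|] := ltP (h u) +oo%E; last first.
    by rewrite leye_eq => /eqP ->; rewrite addye ?leey.
  move: (mphi u hu) hpm; rewrite (hfin u hu) (hfin p hpf) -!EFinD !lee_fin /phi; lra.
(* If [h p] exceeded the bound by [e], so would [h (w n)] eventually. Half of [e] covers the error
   of [w n] in [m], the other half the convergence of the quadratic term: a contradiction. *)
apply/lee_addgt0Pr => e e0; rewrite -EFinD leNgt; apply/negP => hlt.
have [V pV hV] := hl _ _ hlt.
have [N _ hN'] : \forall n \near \oo, False; last by exact: (hN' N (leqnn N)).
have e4 : 0 < e / 2 by rewrite divr_gt0.
have nc : 2^-1 * `|w n - x| ^+ 2 @[n --> \oo] --> 2^-1 * `|p - x| ^+ 2.
  apply: cvgM; first exact: cvg_cst.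
  have : `|w n - x| @[n --> \oo] --> `|p - x|.
    by apply: cvg_norm; apply: cvgB => //; exact: cvg_cst.
  by move=> nn; under eq_fun do rewrite expr2; rewrite expr2; apply: cvgM.
near=> n.
have [wf wlt] := hw n.
have A1 : ((m - 2^-1 * `|p - x| ^+ 2 + e)%:E < h (w n))%E.
  by apply: hV; near: n; exact: wp.
have A2 : n.+1%:R^-1 < e / 2.
  by near: n; exact: (near_infty_natSinv_lt (PosNum e4)).
have A3 : `|2^-1 * `|p - x| ^+ 2 - 2^-1 * `|w n - x| ^+ 2| < e / 2.
  by near: n; exact: (@cvgr_dist_lt _ _ _ _ _ _ _ nc).
move: A1 wlt; rewrite (hfin _ wf) lte_fin /phi.
have := ler_norm (2^-1 * `|p - x| ^+ 2 - 2^-1 * `|w n - x| ^+ 2).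
by move: (n.+1%:R^-1) A2 => d *; lra.
Unshelve. all: by end_near. Qed.

(** Compare the minimizer [p] with the point at parameter [s] on the segment from [p] to [u]:
    dividing by [s] leaves an error of order [s], which is then sent to 0. *)
Lemma prox_variational h x : proper_fun h -> econvex_function h ->
  lower_semicontinuous h ->
  exists hp, h (prox h x) = hp%:E /\
    forall u, ((hp + inner (x - prox h x) (u - prox h x))%:E <= h u)%E.
Proof.
move=> hp hc hl; set p := prox h x.
have pm : minimizer (fun u => h u + (2^-1 * `|u - x| ^+ 2)%:E)%E p.
  exact: (xgetPex _ (prox_exists x hp hc hl)).
have [hN [x0 hx0]] := hp.
have hpf : (h p < +oo)%E.
  have [a ha] : exists a, h x0 = a%:E by apply: proper_fin; rewrite ?ltey.
  have := pm x0; rewrite ha -EFinD; case: (h p) => [s| |] //=.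
  by rewrite ltey.
have [b hb] := proper_fin hp hpf; exists b; split => // u.
have [hu|] := ltP (h u) +oo%E; last by rewrite leye_eq => /eqP ->; rewrite leey.
have [a ha] := proper_fin hp hu; rewrite ha lee_fin.
suff key s : 0 < s < 1 ->
    b + inner (x - p) (u - p) <= a + s / 2 * `|u - p| ^+ 2.
  apply/ler_addgt0Pr => e e0.
  pose q := 1 + `|u - p| ^+ 2.
  have q0 : 1 <= q by rewrite lerDl sqr_ge0.
  (* This choice lies in (0, 1) and satisfies [s * q <= e], even when [u = p]. *)
  pose s := e / (e + q).
  have s01 : 0 < s < 1.
    rewrite divr_gt0 ?ltr_pdivrMr; lra.
  apply: le_trans (key s s01) _; rewrite lerD2l.
  have : s * q <= e.
    by rewrite /s mulrAC ler_pdivrMr; nra.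
  rewrite /q; nra.
move=> s01; have [s0 s1] := andP s01.
have := hc u p s hu hpf s01; set z := (_ + _)%R; rewrite ha hb -!EFinM -EFinD => hz.
have hz' : (h z < +oo)%E by apply: le_lt_trans hz _; rewrite ltey.
have [d hd] := proper_fin hp hz'.
move: hz (pm z); rewrite hd hb -!EFinD !lee_fin.
have -> : z - x = s *: (u - p) - (x - p).
  by rewrite /z scalerBl scale1r scalerBr opprB !addrA; congr (_ - _); rewrite addrAC.
rewrite (normB_sqr (s *: _)) (distrC p x) innerZl (innerC (u - p)) normrZ exprMn
  gtr0_norm// => h1 h2.
rewrite -(ler_pM2l s0); nra.
Qed.

End Prox.


(** Supplies the semicontinuity needed to apply the proximal results to multiples of [g] and to
    linear functionals. *)
Lemma lipschitz_lower_semicontinuous (R : realType) (H : hilbertType R)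
    (phi : H -> R) (c : R) :
  (forall u v, phi u - phi v <= c * `|u - v|) ->
  lower_semicontinuous (EFin \o phi).
Proof.
move=> lip x a /=; rewrite lte_fin => ax.
have c1 : 0 < `|c| + 1 by rewrite ltr_wpDl.
exists (ball x ((phi x - a) / (`|c| + 1))).
  by apply: nbhsx_ballx; rewrite divr_gt0// subr_gt0.
move=> y; rewrite -ball_normE /= lte_fin ltr_pdivlMr// => xy.
have := lip x y; have := ler_wpM2r (normr_ge0 (x - y)) (ler_norm c).
have := normr_ge0 (x - y); nra.
Qed.

(** * Operator norm and adjoint *)

Section Operator.
Context (R : realType) (H G : hilbertType R) (K : {linear H -> G}).
Hypothesis K_cont : continuous K.

Lemma opnorm_ubound : has_ubound [set `|K x| | x in [set x : H | `|x| <= 1]].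
Proof.
move/linear_bounded_continuous/bounded_funP : K_cont => /(_ 1)[M hM].
by exists M => _ [x /= x1 <-]; exact: hM.
Qed.

Lemma le_opnorm x : `|K x| <= opnorm K * `|x|.
Proof.
have [->|x0] := eqVneq x 0; first by rewrite linear0 !normr0 mulr0.
have n0 : 0 < `|x| by rewrite normr_gt0.
rewrite -ler_pdivrMr//; apply: (ub_le_sup opnorm_ubound) => /=.
exists (`|x|^-1 *: x).
  by rewrite normrZ ger0_norm ?invr_ge0// mulVf ?gt_eqF.
by rewrite linearZ /= normrZ ger0_norm ?invr_ge0// mulrC.
Qed.

Lemma opnorm_gt0 : (exists x, K x != 0) -> 0 < opnorm K.
Proof.
move=> [x Kx0]; have Kx : 0 < `|K x| by rewrite normr_gt0.
have := lt_le_trans Kx (le_opnorm x).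
rewrite pmulr_lgt0// normr_gt0; apply: contraNneq Kx0 => ->.
by rewrite linear0.
Qed.

(* Riesz representation: the vector representing [l x = inner (K x) y] is the
   proximal point of [- l] at [0]. *)
Lemma adjointP x y : inner (K x) y = inner x (adjoint K y).
Proof.
suff : exists z, forall x, inner (K x) y = inner x z.
  by move=> /(xgetPex 0)/(_ x).
pose h := EFin \o (fun x => - inner (K x) y).
have hl : lower_semicontinuous h.
  apply: (@lipschitz_lower_semicontinuous _ _ _ (opnorm K * `|y|)) => u v.
  rewrite opprK addrC -innerNl -innerDl -linearN -linearD.
  apply: (le_trans (inner_le_norm _ _)); rewrite mulrAC ler_wpM2r//.
  by rewrite (distrC u) le_opnorm.
have hp : proper_fun h by split; [move=> u | exists 0].
have hc : econvex_function h.
  move=> u v a _ _ _; rewrite /h /= -!EFinM -EFinD lee_fin.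
  rewrite linearD !linearZ /= !innerE; lra.
have [b [hb hv]] := prox_variational 0 hp hc hl.
set p := prox h 0 in hb hv.
move: hb => [hb].
(* The variational inequality at [u + p] gives one direction; linearity, through [- u], gives the
   other. *)
have le u : inner (K u) y <= inner u p.
  have := hv (u + p); rewrite /h /= lee_fin -hb addrK sub0r innerNl.
  by rewrite linearD /= innerDl (innerC p); lra.
exists p => u; apply/le_anti/andP; split; first exact: le.
by have := le (- u); rewrite linearN /= !innerNl lerN2.
Qed.

End Operator.

(** * The Moreau envelope of [g] and its gradient *)

Section MoreauEnvelope.
Context (R : realType) (G : hilbertType R) (g : G -> R) (L : R).
Hypothesis g_convex : forall u v (a : R), 0 < a < 1 ->
  g (a *: u + (1 - a) *: v) <= a * g u + (1 - a) * g v.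
Hypothesis g_lip : forall u v, g u - g v <= L * `|u - v|.
Implicit Types (mu : R) (u w z : G).

Definition prox_scaled mu z := prox (fun u => (mu * g u)%:E) z.

Definition envelope_grad mu z := mu^-1 *: (z - prox_scaled mu z).

(* The term [(2 * mu)^-1 * `|z - v| ^+ 2], for [v] the proximal point, is written
   as [mu / 2] times the squared norm of the gradient [mu^-1 *: (z - v)]. *)
Definition envelope mu z :=
  g (prox_scaled mu z) + mu / 2 * `|envelope_grad mu z| ^+ 2.

Lemma envelope_gradK mu z : 0 < mu ->
  z = prox_scaled mu z + mu *: envelope_grad mu z.
Proof.
by move=> mu0; rewrite scalerA mulfV ?gt_eqF// scale1r addrC subrK.
Qed.

(** This is the variational inequality for the proximal point of [mu * g], divided by [mu]. *)
Lemma envelope_subgradient mu z u : 0 < mu ->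
  g (prox_scaled mu z) + inner (envelope_grad mu z) (u - prox_scaled mu z) <= g u.
Proof.
move=> mu0; pose h := EFin \o (fun u => mu * g u).
have hl : lower_semicontinuous h.
  apply: (@lipschitz_lower_semicontinuous _ _ _ (mu * L)) => v w.
  by rewrite -mulrBr -mulrA ler_pM2l.
have hp : proper_fun h by split; [move=> v | exists 0].
have hc : econvex_function h.
  move=> v w a _ _ a01; rewrite /h /= -!EFinM -EFinD lee_fin.
  by have := g_convex v w a01; nra.
have [b [[hb] /(_ u)]] := prox_variational z hp hc hl.
rewrite /h /= lee_fin -hb -/(prox_scaled mu z) innerZl => le.
by rewrite -(ler_pM2l mu0) mulrDr mulVKf ?gt_eqF.
Qed.

(** The subgradient inequality makes Fenchel-Young an equality at the pair of [v] and [p]. This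
    fixes the conjugate at [p], while [v] still bounds it below at every other [q]. *)
Lemma prox_conjugateE mu z : 0 < mu ->
  prox (fun p => (mu^-1)%:E * conjugate (EFin \o g) p)%E (mu^-1 *: z) =
  envelope_grad mu z.
Proof.
move=> mu0; have mui0 : 0 < mu^-1 by rewrite invr_gt0.
set p := envelope_grad mu z; set v := prox_scaled mu z.
have conj_ge q : ((inner v q - g v)%:E <= conjugate (EFin \o g) q)%E.
  by apply: ereal_sup_ubound; exists v.
have conj_p : conjugate (EFin \o g) p = (inner v p - g v)%:E.
  apply/le_anti; rewrite conj_ge andbT; apply: ge_ereal_sup => _ [u _ <-].
  rewrite -EFinB lee_fin.
  have := envelope_subgradient z u mu0; rewrite -/p -/v innerDr innerNr.
  rewrite (innerC p) (innerC p); lra.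
(* Quadratic growth around [p], giving minimality and uniqueness at once. Once the conjugate at [q]
   is replaced by its lower bound through [v], the two sides are equal. *)
have strong q : (mu^-1%:E * conjugate (EFin \o g) p +
      (2^-1 * `|p - mu^-1 *: z| ^+ 2 + 2^-1 * `|q - p| ^+ 2)%:E <=
    mu^-1%:E * conjugate (EFin \o g) q + (2^-1 * `|q - mu^-1 *: z| ^+ 2)%:E)%E.
  apply: (@le_trans _ _ (mu^-1 * (inner v q - g v) +
      2^-1 * `|q - mu^-1 *: z| ^+ 2)%:E); last first.
    by rewrite EFinD EFinM leeD2r// lee_pmul2l.
  rewrite conj_p -EFinM -EFinD lee_fin.
  rewrite (envelope_gradK z mu0) -/p -/v scalerDr scalerA mulVf ?gt_eqF// scale1r.
  clearbody p v; rewrite -!inner_norm !innerE.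
  rewrite (innerC q p) (innerC v p) (innerC v q); lra.
apply: xget_unique => [q|q qmin].
  apply: (le_trans _ (strong q)); rewrite leeD2l// lee_fin lerDl.
  by rewrite mulr_ge0 ?sqr_ge0.
have := le_trans (strong q) (qmin p).
rewrite conj_p -EFinM -!EFinD lee_fin => h.
have : `|q - p| ^+ 2 == 0 by rewrite eq_le sqr_ge0 andbT; lra.
by rewrite sqrf_eq0 normr_eq0 subr_eq0 => /eqP.
Qed.

(** The envelope is an infimal convolution. The subgradient inequality reduces the bound to |u -
    v|^2 >= 0, with [v] the proximal point. *)
Lemma envelope_le mu z u : 0 < mu ->
  envelope mu z <= g u + (2 * mu)^-1 * `|u - z| ^+ 2.
Proof.
move=> mu0; rewrite /envelope.
have := envelope_subgradient z u mu0.
set p := envelope_grad mu z; set v := prox_scaled mu z => h.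
rewrite {1}(envelope_gradK z mu0) -/p -/v.
rewrite (_ : u - (v + mu *: p) = (u - v) - mu *: p); last by rewrite opprD addrA.
clearbody p v; rewrite normB_sqr normrZ exprMn gtr0_norm// innerZr (innerC (u - v)).
have n0 := sqr_ge0 `|u - v|.
have -> : (2 * mu)^-1 * (`|u - v| ^+ 2 - 2 * (mu * inner p (u - v)) +
    mu ^+ 2 * `|p| ^+ 2) = (2 * mu)^-1 * `|u - v| ^+ 2 - inner p (u - v) +
    mu / 2 * `|p| ^+ 2 by field; rewrite gt_eqF.
have : 0 <= (2 * mu)^-1 * `|u - v| ^+ 2 by rewrite mulr_ge0// invr_ge0 mulr_ge0// ltW.
lra.
Qed.

(** With p the envelope gradient, the Lipschitz bound costs L mu |p|, and L |p| - |p|^2 / 2 <= L^2 /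
    2. *)
Lemma le_envelope mu z : 0 < mu -> g z <= envelope mu z + mu / 2 * L ^+ 2.
Proof.
move=> mu0; rewrite /envelope.
have := g_lip z (prox_scaled mu z).
rewrite [z - _](_ : _ = mu *: envelope_grad mu z); last first.
  by rewrite {1}(envelope_gradK z mu0) addrAC subrr add0r.
rewrite normrZ gtr0_norm//.
have := sqr_ge0 (`|envelope_grad mu z| - L); nra.
Qed.

(** Smoothness with constant 1 / mu: use the proximal point of [z] as a competitor in the envelope
    at [w]; the rest is an identity. *)
Lemma envelope_descent mu z w : 0 < mu ->
  envelope mu w <= envelope mu z + inner (envelope_grad mu z) (w - z) +
    (2 * mu)^-1 * `|w - z| ^+ 2.
Proof.
move=> mu0; apply: le_trans (envelope_le w (prox_scaled mu z) mu0) _.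
rewrite /envelope; have := envelope_gradK z mu0.
move: (prox_scaled mu z) (envelope_grad mu z) => v p ->.
have -> : v - w = - (mu *: p + (w - (v + mu *: p))).
  by rewrite (addrC v (mu *: p)) [- (_ + v)]opprD addrCA addNKr opprB.
rewrite normrN (normD_sqr (mu *: p)) normrZ exprMn gtr0_norm// innerZl.
by rewrite le_eqVlt; apply/orP; left; apply/eqP; field; rewrite gt_eqF.
Qed.

Lemma envelope_linearization mu z u : 0 < mu ->
  envelope mu z + inner (envelope_grad mu z) (u - z) <=
  g u - mu / 2 * `|envelope_grad mu z| ^+ 2.
Proof.
move=> mu0; have := envelope_subgradient z u mu0; rewrite /envelope.
set p := envelope_grad mu z; set v := prox_scaled mu z.
rewrite (_ : u - z = (u - v) - mu *: p); last first.
  by rewrite {1}(envelope_gradK z mu0) -/p -/v opprD addrA.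
clearbody p v; rewrite [inner p (_ - _ *: _)]innerDr innerNr innerZr inner_norm; lra.
Qed.

(* The gradients at two smoothing levels are compared through the dual form
   [max_q (inner w q - conjugate g q - mu / 2 * `|q| ^+ 2)] of the envelope. *)
Lemma envelope_linearization_change mu mu' z w : 0 < mu -> 0 < mu' ->
  envelope mu z + inner (envelope_grad mu z) (w - z) <=
  envelope mu' w + (mu' - mu) / 2 * `|envelope_grad mu z| ^+ 2.
Proof.
move=> mu0 mu'0; have := envelope_linearization z (prox_scaled mu' w) mu0.
rewrite [envelope mu' w]/envelope; set p := envelope_grad mu z.
set p' := envelope_grad mu' w; set v := prox_scaled mu' w.
have -> : w - z = (v - z) + mu' *: p'.
  by rewrite {1}(envelope_gradK w mu'0) -/p' -/v addrAC.
clearbody p p' v; rewrite [inner p (_ + _ *: _)]innerDr innerZr => h.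
have : 0 <= `|p - p'| ^+ 2 by exact: sqr_ge0.
rewrite normB_sqr; nra.
Qed.

End MoreauEnvelope.


(** * One step of the algorithm and its energy decrease *)

Section VastStep.
Context (R : realType) (H G : hilbertType R) (f : H -> \bar R) (g : G -> R).
Context (L : R) (K : {linear H -> G}).
Hypotheses (f_proper : proper_fun f) (f_convex : econvex_function f).
Hypothesis f_lsc : lower_semicontinuous f.
Hypothesis g_convex : forall u v (a : R), 0 < a < 1 ->
  g (a *: u + (1 - a) *: v) <= a * g u + (1 - a) * g v.
Hypothesis g_lip : forall u v, g u - g v <= L * `|u - v|.
Hypothesis K_cont : continuous K.

Definition vast_update gam mu y :=
  prox (fun u => gam%:E * f u)%E
    (y - gam *: adjoint K (envelope_grad g mu (K y))).

Lemma scaled_prox_variational gam w : 0 < gam ->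
  let x := prox (fun u => gam%:E * f u)%E w in
  exists fx, f x = fx%:E /\ forall u fu, f u = fu%:E ->
    fx + gam^-1 * inner (w - x) (u - x) <= fu.
Proof.
move=> gam0 x; have [fN [x0 fx0]] := f_proper.
have scale_lty u : (gam%:E * f u < +oo)%E -> (f u < +oo)%E.
  by case: (f u) => [r _| |]; rewrite ?ltry ?ltNyy// gt0_muley.
have hp : proper_fun (fun u => gam%:E * f u)%E.
  split=> [u|]; last first.
    exists x0; case: (f x0) fx0 (fN x0) => [r| |] //= _ _; by rewrite -EFinM.
  by case: (f u) (fN u) => [r| |] //= _; rewrite -?EFinM// gt0_muley.
have hc : econvex_function (fun u => gam%:E * f u)%E.
  move=> u v a hu hv a01.
  have fu := scale_lty _ hu; have fv := scale_lty _ hv.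
  have [ru hru] := proper_fin f_proper fu; have [rv hrv] := proper_fin f_proper fv.
  have := f_convex fu fv a01; set z := (_ + _)%R; rewrite hru hrv -!EFinM -!EFinD => hz.
  have [rz hrz] : exists r, f z = r%:E.
    by apply: proper_fin => //; apply: le_lt_trans hz _; rewrite ltry.
  by move: hz; rewrite hrz -EFinM !lee_fin; nra.
have hl : lower_semicontinuous (fun u => gam%:E * f u)%E.
  move=> u a; rewrite -lte_pdivrMl// -EFinM => /f_lsc[V uV hV].
  by exists V => // v /hV; rewrite EFinM lte_pdivrMl.
have [b [hb hv]] := prox_variational w hp hc hl; rewrite -/x in hb hv.
have [fx hfx] : exists r, f x = r%:E.
  by apply: proper_fin => //; apply: scale_lty; rewrite hb ltry.
exists fx; split => // u fu hfu; have := hv u.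
move: hb; rewrite hfx hfu -!EFinM => -[<-]; rewrite lee_fin => le.
by rewrite -(ler_pM2l gam0) mulrDr mulVKf ?gt_eqF.
Qed.

(** The descent inequality costs |K x - K y|^2 / (2 mu). Since [gam * opnorm K ^+ 2 = mu], this is
    at most |x - y|^2 / (2 gam), which the prox inequality provides when its inner product is
    polarized. *)
Lemma vast_update_le gam mu y : 0 < gam -> 0 < mu -> gam * opnorm K ^+ 2 = mu ->
  let x := vast_update gam mu y in
  exists fx, f x = fx%:E /\ forall u fu, f u = fu%:E ->
    fx + envelope g mu (K x) <=
    fu + (envelope g mu (K y) + inner (envelope_grad g mu (K y)) (K u - K y)) +
    (2 * gam)^-1 * (`|y - u| ^+ 2 - `|x - u| ^+ 2).
Proof.
move=> gam0 mu0 gamK x.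
have [fx [hfx hx]] := scaled_prox_variational
  (y - gam *: adjoint K (envelope_grad g mu (K y))) gam0.
rewrite -/(vast_update gam mu y) -/x in hfx hx.
exists fx; split => // u fu /hx.
have := envelope_descent g_convex g_lip (K y) (K x) mu0.
set p := envelope_grad g mu (K y).
have -> : (2 * mu)^-1 * `|K x - K y| ^+ 2 =
    (2 * gam)^-1 * (`|K x - K y| ^+ 2 / opnorm K ^+ 2).
  have : gam * opnorm K ^+ 2 != 0 by rewrite gamK gt_eqF.
  rewrite mulf_eq0 sqrf_eq0 negb_or => /andP[g0 k0].
  by rewrite -gamK; field; rewrite k0.
have Kxy : `|K x - K y| ^+ 2 / opnorm K ^+ 2 <= `|x - y| ^+ 2.
  have op0 : 0 < opnorm K ^+ 2 by rewrite -(pmulr_rgt0 _ gam0) gamK.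
  rewrite ler_pdivrMr// mulrC -exprMn -linearB.
  rewrite ler_sqr ?nnegrE// ?le_opnorm//.
  exact: le_trans (normr_ge0 _) (le_opnorm K_cont _).
clearbody p.
have -> : y - gam *: adjoint K p - x = (y - x) - gam *: adjoint K p.
  by rewrite addrAC.
rewrite [inner (_ - _ *: _) _]innerDl innerNl innerZl.
rewrite [gam^-1 * (_ - _)]mulrBr mulKf ?gt_eqF//.
rewrite (innerC (adjoint K p)) -adjointP// [K (u - x)]linearB (innerC (K u - K x)).
have -> : K u - K x = (K u - K y) - (K x - K y) by rewrite opprB addrA subrK.
rewrite [inner p (_ - (_ - _))]innerDr innerNr.
have -> : y - u = (y - x) - (u - x) by rewrite opprB addrA subrK.
rewrite (normB_sqr (y - x)) (distrC x u).
have gi0 : 0 <= (2 * gam)^-1 by rewrite invr_ge0 mulr_ge0// ltW.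
have := ler_wpM2l gi0 Kxy; rewrite (distrC x y).
have -> : (2 * gam)^-1 * (`|y - x| ^+ 2 - 2 * inner (y - x) (u - x) +
   `|u - x| ^+ 2 - `|u - x| ^+ 2) = (2 * gam)^-1 * `|y - x| ^+ 2 -
   gam^-1 * inner (y - x) (u - x) by field; rewrite gt_eqF.
lra.
Qed.

(** Used at both [y] and [x]: it turns the weighted distances into the energy norms, and the term in
    |u - v|^2 cancels in the difference. *)
Lemma norm_sqr_combination (s : R) (y u v : H) :
  s * (s - 1) * `|y - u| ^+ 2 + s * `|y - v| ^+ 2 =
  `|s *: y - (s - 1) *: u - v| ^+ 2 + (s - 1) * `|u - v| ^+ 2.
Proof.
rewrite -!inner_norm !innerE (innerC u y) (innerC v y) (innerC v u); ring.
Qed.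

(* Weighting the prox inequality at [xk] by [1 - s^-1] and at [xs] by [s^-1],
   the slack [mu / 2 * `|p| ^+ 2] of the linearization at [xs] absorbs the
   increase of the envelope caused by passing from [mu'] to [mu]. *)
Lemma vast_energy_decrease gam mu mu' s xk y xs fk fs :
  0 < gam -> 0 < mu -> 0 < mu' -> gam * opnorm K ^+ 2 = mu ->
  1 < s -> mu' - mu - mu / s <= 0 ->
  f xk = fk%:E -> f xs = fs%:E ->
  let x := vast_update gam mu y in
  exists fx, f x = fx%:E /\
    gam * s ^+ 2 * (fx + envelope g mu (K x) - (fs + g (K xs))) +
      2^-1 * `|s *: x - (s - 1) *: xk - xs| ^+ 2 <=
    (1 - s^-1) * gam * s ^+ 2 *
        (fk + envelope g mu' (K xk) - (fs + g (K xs))) +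
      2^-1 * `|s *: y - (s - 1) *: xk - xs| ^+ 2.
Proof.
move=> gam0 mu0 mu'0 gamK s1 mumu hfk hfs x.
have [fx [hfx hx]] := vast_update_le y gam0 mu0 gamK; rewrite -/x in hfx hx.
exists fx; split => //.
have s0 : 0 < s by exact: lt_trans s1.
have hk := hx _ _ hfk; have hs := hx _ _ hfs.
have lk := envelope_linearization_change g_convex g_lip (K y) (K xk) mu0 mu'0.
have ls := envelope_linearization g_convex g_lip (K y) (K xs) mu0.
set P := `|envelope_grad g mu (K y)| ^+ 2 in lk ls.
have P0 : 0 <= P by exact: sqr_ge0.
set A := fx + _ in hk hs *; set B := envelope g mu' _ in lk *.
set gs := g (K xs) in ls *.
have {lk}hk : A <= fk + B + (mu' - mu) / 2 * P +
    (2 * gam)^-1 * (`|y - xk| ^+ 2 - `|x - xk| ^+ 2) by lra.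
have {ls}hs : A <= fs + gs - mu / 2 * P +
    (2 * gam)^-1 * (`|y - xs| ^+ 2 - `|x - xs| ^+ 2) by lra.
have muS : s * mu' - s * mu - mu <= 0.
  have sE : mu / s * s = mu by rewrite divfK ?gt_eqF.
  have := ler_wpM2l (ltW s0) mumu; rewrite mulr0; lra.
have ny := norm_sqr_combination s y xk xs.
have nx := norm_sqr_combination s x xk xs.
have cancel (D : R) : gam * ((2 * gam)^-1 * D) = 2^-1 * D by field; rewrite gt_eqF.
move: (2 * gam)^-1 hk hs cancel => gi hk hs cancel.
(* The weights [1 - s^-1] and [s^-1] are multiplied by [gam * s ^+ 2], giving [gam * s * (s - 1)]
   here and [gam * s] in [hs']. *)
have hk' : gam * s * (s - 1) * A <= gam * s * (s - 1) * (fk + B) +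
    gam * s * (s - 1) * ((mu' - mu) / 2 * P) +
    2^-1 * (s * (s - 1) * `|y - xk| ^+ 2 - s * (s - 1) * `|x - xk| ^+ 2).
  have c0 : 0 <= gam * s * (s - 1) by rewrite !mulr_ge0 ?subr_ge0// ltW.
  have := ler_wpM2l c0 hk.
  have := cancel (s * (s - 1) * (`|y - xk| ^+ 2 - `|x - xk| ^+ 2)); lra.
have hs' : gam * s * A <= gam * s * (fs + gs) - gam * s * (mu / 2 * P) +
    2^-1 * (s * `|y - xs| ^+ 2 - s * `|x - xs| ^+ 2).
  have c0 : 0 <= gam * s by rewrite mulr_ge0// ltW.
  have := ler_wpM2l c0 hs.
  have := cancel (s * (`|y - xs| ^+ 2 - `|x - xs| ^+ 2)); lra.
have slack : (s - 1) * ((mu' - mu) / 2 * P) <= mu / 2 * P.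
  rewrite mulrA ler_wpM2r//; nra.
have slack' : gam * s * ((s - 1) * ((mu' - mu) / 2 * P)) <= gam * s * (mu / 2 * P).
  by rewrite ler_pM2l// mulr_gt0.
have -> : (1 - s^-1) * gam * s ^+ 2 = gam * s * (s - 1) by field; rewrite gt_eqF.
lra.
Qed.

End VastStep.


(** * Growth of the parameters *)

Section StepSizes.
Context (R : realType).

Lemma parameter_step (t s : R) : 1 <= t -> s = Num.sqrt (t ^+ 2 + 2 * t) ->
  [/\ s ^+ 2 = t ^+ 2 + 2 * t, 1 < s, t + 2^-1 <= s & s <= t + 1].
Proof.
move=> t1 sE.
have s2 : s ^+ 2 = t ^+ 2 + 2 * t by rewrite sE sqr_sqrtr//; nra.
have s0 : 0 <= s by rewrite sE sqrtr_ge0.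
have ts : t + 2^-1 <= s.
  by rewrite -(@ler_pXn2r _ 2)// ?nnegrE//; [rewrite s2; nra | lra].
split => //; first by lra.
by rewrite -(@ler_pXn2r _ 2)// ?nnegrE//; [rewrite s2; nra | lra].
Qed.

(* Equivalently, [gamma k * (t k + 2)] is nonincreasing in [k]. *)
Lemma parameter_step_le (t s : R) : 1 <= t -> 0 <= s ->
  s ^+ 2 = t ^+ 2 + 2 * t -> t ^+ 2 * (s + 2) <= (t + 2) * (s ^+ 2 - s).
Proof.
move=> t1 s0 s2.
suff : s * (t ^+ 2 + t + 2) <= t ^+ 3 + 2 * t ^+ 2 + 4 * t by rewrite s2; nra.
(* After squaring and eliminating [s], the difference of the two sides is a polynomial in
   [d = t - 1] with nonnegative coefficients. *)
have [d d0 td] : exists2 d, 0 <= d & t = 1 + d by exists (t - 1); lra.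
have d2 : 0 <= d ^+ 2 by rewrite exprn_ge0.
have d3 : 0 <= d ^+ 3 by rewrite exprn_ge0.
have d4 : 0 <= d ^+ 4 by rewrite exprn_ge0.
rewrite -(@ler_pXn2r _ 2)// ?nnegrE; last 2 first.
- by rewrite mulr_ge0// td; lra.
- by rewrite td; lra.
by rewrite exprMn s2 td; lra.
Qed.

Variable t : nat -> R.
Hypothesis t_1 : t 1%N = 1.
Hypothesis t_rec : forall k : nat, (1 <= k)%N ->
  t k.+1 = Num.sqrt (t k ^+ 2 + 2 * t k).

Lemma parameter_bounds n :
  [/\ 1 <= t n.+1, (n%:R + 2) / 2 <= t n.+1 & t n.+1 <= n%:R + 1].
Proof.
elim: n => [|n [t1 lt tu]]; first by rewrite t_1; split; lra.
have [s2 s1 ls us] := parameter_step t1 (t_rec (ltn0Sn n)).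
by rewrite -natr1; split; lra.
Qed.

Variables (mu gamma : nat -> R) (b op : R).
Hypotheses (b_gt0 : 0 < b) (op_gt0 : 0 < op).
Hypothesis mu_1 : mu 1%N = b * op ^+ 2.
Hypothesis mu_rec : forall k : nat, (1 <= k)%N ->
  mu k.+1 = mu k * (t k ^+ 2 / (t k.+1 ^+ 2 - t k.+1)).
Hypothesis gamma_def : forall k : nat, (1 <= k)%N -> gamma k = mu k / op ^+ 2.

Lemma mu_gt0 n : 0 < mu n.+1.
Proof.
elim: n => [|n IH]; first by rewrite mu_1 mulr_gt0 ?exprn_gt0.
have [t1 _ _] := parameter_bounds n.
have [s2 s1 _ _] := parameter_step t1 (t_rec (ltn0Sn n)).
rewrite mu_rec// mulr_gt0// divr_gt0 ?exprn_gt0//; first by lra.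
by rewrite expr2; nra.
Qed.

Lemma gamma_gt0 n : 0 < gamma n.+1.
Proof. by rewrite gamma_def// divr_gt0 ?mu_gt0 ?exprn_gt0. Qed.

Lemma gamma_1 : gamma 1%N = b.
Proof. by rewrite gamma_def// mu_1 mulfK ?gt_eqF ?exprn_gt0. Qed.

Lemma gamma_rec n :
  gamma n.+2 * (t n.+2 ^+ 2 - t n.+2) = gamma n.+1 * t n.+1 ^+ 2.
Proof.
have [t1 _ _] := parameter_bounds n.
have [s2 s1 _ _] := parameter_step t1 (t_rec (ltn0Sn n)).
have s0 : t n.+2 ^+ 2 - t n.+2 != 0 by rewrite gt_eqF// expr2; nra.
rewrite !gamma_def// mu_rec//; field.
by rewrite s0 gt_eqF.
Qed.

Lemma parameter_identity n :
  (1 - (t n.+2)^-1) * gamma n.+2 * t n.+2 ^+ 2 = gamma n.+1 * t n.+1 ^+ 2.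
Proof.
have [t1 _ _] := parameter_bounds n.+1.
by rewrite -(gamma_rec n); field; rewrite gt_eqF//; lra.
Qed.

(** Clearing denominators leaves s^2 (s - 1) <= t^2 (s + 1); with s^2 = t^2 + 2 t this is exactly s
    <= t + 1. *)
Lemma parameter_condition n : mu n.+1 - mu n.+2 - mu n.+2 / t n.+2 <= 0.
Proof.
have [t1 _ _] := parameter_bounds n.
have [s2 s1 _ us] := parameter_step t1 (t_rec (ltn0Sn n)).
set s := t n.+2 in s2 s1 us *.
have s0 : 0 < s by lra.
have d0 : 0 < s ^+ 2 - s by rewrite expr2; nra.
have -> : mu n.+1 - mu n.+2 - mu n.+2 / s =
    mu n.+1 / (s ^+ 2 - s) * ((s ^+ 2 - s) - t n.+1 ^+ 2 * (1 + s^-1)).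
  by rewrite (mu_rec (ltn0Sn n)) -/s; field; rewrite !gt_eqF.
rewrite pmulr_rle0 ?divr_gt0 ?mu_gt0// -(pmulr_rle0 _ s0).
have -> : s * (s ^+ 2 - s - t n.+1 ^+ 2 * (1 + s^-1)) =
    s ^+ 2 * (s - 1) - t n.+1 ^+ 2 * (s + 1) by field; rewrite gt_eqF.
by rewrite s2; nra.
Qed.

Lemma gamma_le n : gamma n.+1 * (t n.+1 + 2) <= 3 * b.
Proof.
elim: n => [|n IH]; first by rewrite gamma_1 t_1; lra.
have [t1 _ _] := parameter_bounds n.
have [s2 s1 _ us] := parameter_step t1 (t_rec (ltn0Sn n)).
have d0 : 0 < t n.+2 ^+ 2 - t n.+2 by rewrite expr2; nra.
apply: le_trans IH; rewrite -(ler_pM2r d0) mulrAC gamma_rec.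
rewrite -!(mulrA (gamma n.+1)) ler_pM2l ?gamma_gt0//.
by apply: parameter_step_le => //; lra.
Qed.

(** Each step multiplies the right side by s / (s - 1), with s = [t n.+2]; since s <= n + 2, this
    factor is at least (n + 2) / (n + 1). *)
Lemma gamma_sqr_ge n : b * (n%:R + 1) <= gamma n.+1 * t n.+1 ^+ 2.
Proof.
elim: n => [|n IH]; first by rewrite gamma_1 t_1; lra.
have [t1 _ _] := parameter_bounds n.
have [_ _ tu] := parameter_bounds n.+1; rewrite -natr1 in tu.
have [s2 s1 _ us] := parameter_step t1 (t_rec (ltn0Sn n)).
have c0 : 0 < t n.+2 - 1 by lra.
rewrite -(ler_pM2r c0).
have -> : gamma n.+2 * t n.+2 ^+ 2 * (t n.+2 - 1) =
    (gamma n.+1 * t n.+1 ^+ 2) * t n.+2 by rewrite -(gamma_rec n); ring.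
apply: (@le_trans _ _ (b * (n%:R + 1) * t n.+2)); last by rewrite ler_pM2r//; lra.
by rewrite -!mulrA ler_pM2l// -natr1; lra.
Qed.

End StepSizes.

(** * Energy induction and convergence rate *)

Theorem corollary3p1 (R : realType) (H G : hilbertType R)
  (f : H -> \bar R) (g : G -> R) (Lg : R) (K : {linear H -> G})
  (f_proper : proper_fun f) (f_convex : econvex_function f)
  (f_lsc : lower_semicontinuous f)
  (g_convex : convex_function [set: convex_lmodType G] g)
  (Lg_gt0 : 0 < Lg) (g_lip : Lg.-lipschitz (g : G -> R^o))
  (K_cont : continuous K) (K_neq0 : exists x : H, K x != 0)
  (F : H -> \bar R) (F_def : forall x : H, F x = (f x + (g (K x))%:E)%E)
  (b : R) (b_gt0 : 0 < b) (t mu gamma : nat -> R)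
  (t_1 : t 1%N = 1) (mu_1 : mu 1%N = b * opnorm K ^+ 2)
  (t_rec : forall k : nat, (1 <= k)%N ->
     t k.+1 = Num.sqrt (t k ^+ 2 + 2 * t k))
  (mu_rec : forall k : nat, (1 <= k)%N ->
     mu k.+1 = mu k * (t k ^+ 2 / (t k.+1 ^+ 2 - t k.+1)))
  (gamma_def : forall k : nat, (1 <= k)%N -> gamma k = mu k / opnorm K ^+ 2) :
  (forall k : nat, (1 <= k)%N ->
     mu k - mu k.+1 - mu k.+1 / t k.+1 <= 0 /\
     (1 - (t k.+1)^-1) * gamma k.+1 * t k.+1 ^+ 2 = gamma k * t k ^+ 2) /\
  (forall x y : nat -> H, VAST f g K mu t x y ->
   forall xs : H, minimizer F xs ->
   forall N : nat, (1 <= N)%N ->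
     (F (x N) - F xs <=
       (`|x 0%N - xs| ^+ 2 / (b * (N%:R + 1))
        + b * Lg ^+ 2 * opnorm K ^+ 2 / (N%:R + 1)
          * expR (4 * pi ^+ 2 / 6))%:E)%E).
Proof.
have op0 := opnorm_gt0 K_cont K_neq0.
split=> [[//|n] _|x y [y0 xy] xs xs_min [//|N] _].
  split; first exact: (parameter_condition t_1 t_rec b_gt0 op0 mu_1 mu_rec).
  exact: (parameter_identity t_1 t_rec op0 mu_rec gamma_def).
have mu0 := mu_gt0 t_1 t_rec b_gt0 op0 mu_1 mu_rec.
have gam0 := gamma_gt0 t_1 t_rec b_gt0 op0 mu_1 mu_rec gamma_def.
have gamK n : gamma n.+1 * opnorm K ^+ 2 = mu n.+1.
  by rewrite gamma_def// divfK// sqrf_eq0 gt_eqF.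
have gcvx u v (a : R) : 0 < a < 1 ->
    g (a *: u + (1 - a) *: v) <= a * g u + (1 - a) * g v.
  move=> /andP[/ltW a0 /ltW a1].
  by have := g_convex (Itv01 a0 a1) u v; rewrite !inE => /(_ Logic.I Logic.I).
have glip u v : g u - g v <= Lg * `|u - v|.
  apply: le_trans (ler_norm _) _.
  exact: (g_lip (u, v)).
have xE n : x n.+1 = vast_update f g K (gamma n.+1) (mu n.+1) (y n).
  have [-> _] := xy n.+1 (ltn0Sn n).
  by rewrite (prox_conjugateE gcvx glip)// invf_div -gamma_def.
have [fs hfs] : exists r, f xs = r%:E.
  apply: proper_fin => //; have [fN [z fz]] := f_proper.
  have [r hr] : exists r, f z = r%:E by apply: proper_fin => //; rewrite ltey.
  have := xs_min z; rewrite !F_def hr -EFinD.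
  by case: (f xs) => [s| |] //= _; rewrite ltry.
(* Shifted index: [U n] is the auxiliary point u_k with k = n + 1. *)
pose U n := x n + t n.+1 *: (x n.+1 - x n).
have energy n : exists fn, f (x n.+1) = fn%:E /\
    gamma n.+1 * t n.+1 ^+ 2 *
      (fn + envelope g (mu n.+1) (K (x n.+1)) - (fs + g (K xs))) +
    2^-1 * `|U n - xs| ^+ 2 <= 2^-1 * `|x 0%N - xs| ^+ 2.
  elim: n => [|n [fn [hfn IH]]].
    (* As [t 1 = 1], the first step has no weight on a previous iterate: the prox inequality at [xs]
       alone suffices. *)
    have [f1 [hf1 h1]] := vast_update_le f_proper f_convex f_lsc gcvx glip
      K_cont (y 0%N) (gam0 0%N) (mu0 0%N) (gamK 0%N).
    rewrite -xE in hf1 h1; exists f1; split => //.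
    have ls := envelope_linearization gcvx glip (K (y 0%N)) (K xs) (mu0 0%N).
    have {h1}h1 := h1 _ _ hfs; rewrite y0 in h1 ls.
    have P0 : 0 <= mu 1 / 2 * `|envelope_grad g (mu 1%N) (K (x 0%N))| ^+ 2.
      by rewrite mulr_ge0 ?sqr_ge0// divr_ge0// ltW// mu0.
    have -> : U 0%N = x 1%N by rewrite /U t_1 scale1r addrC subrK.
    rewrite t_1 expr1n mulr1.
    have hg : gamma 1%N * (2 * gamma 1%N)^-1 = 2^-1.
      by field; rewrite gt_eqF// gam0.
    have le1 : f1 + envelope g (mu 1%N) (K (x 1%N)) - (fs + g (K xs)) <=
        (2 * gamma 1%N)^-1 * (`|x 0%N - xs| ^+ 2 - `|x 1%N - xs| ^+ 2) by lra.
    by have := ler_wpM2l (ltW (gam0 0%N)) le1; rewrite [in X in X -> _]mulrA hg; lra.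
  have [t1 _ _] := parameter_bounds t_1 t_rec n.
  have [s2 s1 _ _] := parameter_step t1 (t_rec n.+1 (ltn0Sn n)).
  have pc := parameter_condition t_1 t_rec b_gt0 op0 mu_1 mu_rec n.
  have [fx [hfx hx]] := vast_energy_decrease f_proper f_convex f_lsc gcvx glip
    K_cont (y n.+1) (gam0 n.+1) (mu0 n.+1) (mu0 n) (gamK n.+1) s1 pc hfn hfs.
  rewrite -xE in hfx hx; exists fx; split => //; apply: le_trans IH.
  rewrite (parameter_identity t_1 t_rec op0 mu_rec gamma_def) in hx.
  have Ux : U n.+1 - xs = t n.+2 *: x n.+2 - (t n.+2 - 1) *: x n.+1 - xs.
    by rewrite /U scalerBr scalerBl scale1r opprB addrCA addrA.
  (* The extrapolation defining [y] is chosen for this identity: the norm on the right of the energy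
     inequality is the previous energy norm. *)
  have Uy : U n - xs = t n.+2 *: y n.+1 - (t n.+2 - 1) *: x n.+1 - xs.
    have [_ ->] := xy n.+1 (ltn0Sn n).
    rewrite scalerDr scalerA mulrC divfK ?gt_eqF//; last by lra.
    rewrite /U /= [X in _ = X - xs]addrAC -scalerBl opprB addrCA subrr addr0 scale1r.
    rewrite scalerBl scale1r opprB [_ *: _ + (_ - _)]addrC addrA.
    by rewrite (addrC _ (x n - _)) subrK.
  by rewrite Ux Uy.
have [fN [hfN hE]] := energy N.
have gN := le_envelope glip (K (x N.+1)) (mu0 N).
rewrite !F_def hfN hfs -!EFinD lee_fin.
have [t1 tl _] := parameter_bounds t_1 t_rec N.
have aN := gamma_sqr_ge t_1 t_rec b_gt0 op0 mu_1 mu_rec gamma_def N.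
have cN := gamma_le t_1 t_rec b_gt0 op0 mu_1 mu_rec gamma_def N.
have U0 : 0 <= `|U N - xs| ^+ 2 by exact: sqr_ge0.
set D := `|x 0%N - xs| ^+ 2 in hE *.
have D0 : 0 <= D by exact: sqr_ge0.
rewrite -natr1; set n : R := N%:R in tl aN *.
have n0 : 0 <= n by rewrite /n.
(* From pi >= 2 and exp a >= 1 + a, the exponential is at least 1 + 16 / 6. *)
have e3 : 3 <= expR (4 * pi ^+ 2 / 6) :> R.
  have := expR_ge1Dx (4 * pi ^+ 2 / 6 : R); have := pi_ge2 R.
  by move: (pi : R) (expR _) => p e; nra.
set E := expR _ in e3 *.
have first_term : fN + envelope g (mu N.+1) (K (x N.+1)) - (fs + g (K xs)) <=
    D / (b * (n + 1 + 1)).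
  rewrite ler_pdivlMr; last by rewrite mulr_gt0//; lra.
  set Z := _ - _ in hE *.
  (* The lower bound [aN] can multiply only a nonnegative gap. The energy then gives Z <= D / (2 b
     (n + 1)), and n + 2 <= 2 (n + 1). *)
  have [Z0|Z0] := leP Z 0.
    by apply: le_trans D0; rewrite mulr_le0_ge0// mulr_ge0 ?ltW//; lra.
  have : 0 <= b * n * Z by rewrite !mulr_ge0// ltW.
  have := ler_wpM2r (ltW Z0) aN; lra.
have second_term : mu N.+1 / 2 * Lg ^+ 2 <=
    b * Lg ^+ 2 * opnorm K ^+ 2 / (n + 1 + 1) * E.
  have -> : b * Lg ^+ 2 * opnorm K ^+ 2 / (n + 1 + 1) * E =
    (b * E / (n + 1 + 1)) * (Lg ^+ 2 * opnorm K ^+ 2) by ring.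
  have -> : mu N.+1 / 2 * Lg ^+ 2 = gamma N.+1 / 2 * (Lg ^+ 2 * opnorm K ^+ 2).
    by rewrite -gamK; ring.
  apply: ler_wpM2r; first by rewrite mulr_ge0 ?sqr_ge0.
  rewrite ler_pdivlMr; last by lra.
  (* By [tl], gamma (n + 2) / 2 <= gamma t <= gamma (t + 2) <= 3 b <= b E. *)
  have := gam0 N; nra.
lra.
Qed.
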